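(* Let $C$ be a non-empty finite subset of $\mathbb{Z}$ and let $X\subseteq\mathbb{N}\setminus\{0\}$ be a $C$-admissible set. The graph ${\rm G}(C,X)$ is a tree with root equal to $\max({\rm NI}(C,X))$. Moreover, the children of a vertex $S\in{\rm NI}(C,X)$ are the elements of the set $$\left\{S\setminus\{a\} : a\in{\rm msg}(S),\ a>{\rm F}(S),\ S\setminus\{a\}\in{\rm NI}(C),\ \text{and } a\notin X\right\}.$$
   Context: $\mathbb{N}$ denotes the set of non-negative integers. For $C\subseteq\mathbb{Z}$, a $C$-incentive is a submonoid $M$ of $(\mathbb{N},+)$ such that $s+t+c\in M$ for all $s,t\in M\setminus\{0\}$ and all $c\in C$; it is numerical if $\gcd(M)=1$ (equivalently, if $\mathbb{N}\setminus M$ is finite). A set $X\subseteq\mathbb{N}$ is $C$-admissible if there exists at least one $C$-incentive containing it. ${\rm NI}(C)$ is the set of all numerical $C$-incentives and ${\rm NI}(C,X)=\{S\in{\rm NI}(C) : X\subseteq S\}$; $\max({\rm NI}(C,X))$ denotes the maximum element of ${\rm NI}(C,X)$ with respect to inclusion. For a submonoid $S$ of $(\mathbb{N},+)$ with $\gcd(S)=1$, ${\rm F}(S)$ is the greatest integer not in $S$. For a submonoid $M$ of $(\mathbb{N},+)$, ${\rm msg}(M)=(M\setminus\{0\})\setminus((M\setminus\{0\})+(M\setminus\{0\}))$ is its minimal system of generators. A graph is a pair $(V,E)$ with $V$ a non-empty set (vertices) and $E\subseteq\{(v,w)\in V\times V: v\ne w\}$ (edges). A path connecting $x$ and $y$ is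 a sequence of different edges $(v_0,v_1),(v_1,v_2),\ldots,(v_{n-1},v_n)$ with $v_0=x$, $v_n=y$. A graph is a tree if there is a vertex $v^*$ (the root) such that for every other vertex $x$ there is a unique path connecting $x$ and $v^*$. If $(x,y)$ is an edge of the tree, $x$ is a child of $y$. The graph ${\rm G}(C,X)$ has vertex set ${\rm NI}(C,X)$, and $(S,S')\in{\rm NI}(C,X)\times{\rm NI}(C,X)$ is an edge if $S'=S\cup\{{\rm F}(S)\}$.
   Formalization: The formal theorem assumes in addition that NI(C,X) is non-empty; C-admissibility of X does not imply this (for C={-4}, X={2} the set NI(C,X) is empty), and then max(NI(C,X)) and the graph G(C,X) do not exist. *)

(* Defs.v *)
From mathcomp Require Import all_boot all_order all_algebra.
From mathcomp Require Import boolp classical_sets cardinality.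

Set Implicit Arguments.
Unset Strict Implicit.
Unset Printing Implicit Defensive.

Import Order.TTheory GRing.Theory Num.Theory.
Local Open Scope classical_set_scope.
Local Open Scope ring_scope.

(* A subset of N seen as a subset of Z. *)
Definition toZ (M : set nat) : set int := Posz @` M.

Definition nonzero (M : set nat) : set nat := M `\ 0%N.

Definition submonoid (M : set nat) : Prop :=
  M 0%N /\ forall s t, M s -> M t -> M (s + t)%N.

Definition is_gcd (M : set nat) (d : nat) : Prop :=
  (forall x, M x -> (d %| x)%N) /\
  (forall e, (forall x, M x -> (e %| x)%N) -> (e %| d)%N).

Definition incentive (C : set int) (M : set nat) : Prop :=
  submonoid M /\
  forall s t c, nonzero M s -> nonzero M t -> C c ->
    toZ M (s%:Z + t%:Z + c).

Definition admissible (C : set int) (X : set nat) : Prop :=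
  exists M, incentive C M /\ X `<=` M.

Definition NI (C : set int) : set (set nat) :=
  [set S | incentive C S /\ is_gcd S 1%N].

Definition NIX (C : set int) (X : set nat) : set (set nat) :=
  [set S | NI C S /\ X `<=` S].

Definition is_maximum (F : set (set nat)) (M : set nat) : Prop :=
  F M /\ forall S, F S -> S `<=` M.

Definition is_frobenius (S : set nat) (z : int) : Prop :=
  ~ toZ S z /\ forall w : int, ~ toZ S w -> w <= z.

(* The default value -1 is used only when there is no greatest integer outside
   S; a submonoid with gcd 1 always has one, and it is -1 for S = setT. *)
Definition Frob (S : set nat) : int := xget (-1) [set z | is_frobenius S z].

Definition msg (M : set nat) : set nat :=
  nonzero M `\` [set (s + t)%N | s in nonzero M & t in nonzero M].

Record graph (T : Type) := Graph {
  vertices : set T;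
  edges : set (T * T);
  vertices_neq0 : vertices !=set0;
  edges_sub : forall e, edges e ->
    [/\ vertices e.1, vertices e.2 & e.1 <> e.2]
}.

Section Graphs.
Variables (T : eqType) (G : graph T).

Fixpoint walk (x y : T) (p : seq (T * T)) : Prop :=
  if p is e :: p' then [/\ edges G e, e.1 = x & walk e.2 y p'] else x = y.

Definition is_path (x y : T) (p : seq (T * T)) : Prop := walk x y p /\ uniq p.

Definition tree_with_root (r : T) : Prop :=
  vertices G r /\
  forall x, vertices G x -> x <> r -> exists! p, is_path x r p.

Definition children (y : T) : set T := [set x | edges G (x, y)].

End Graphs.

(* S' = S U {F(S)} is read as an equality of sets of integers, so that setT,
   whose Frobenius number is -1, has no outgoing edge. *)
Definition GCX_edges (C : set int) (X : set nat) : set (set nat * set nat) :=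
  [set e | [/\ NIX C X e.1, NIX C X e.2 &
               toZ e.2 = toZ e.1 `|` [set Frob e.1]]].

Lemma Frob_notin (S : set nat) : ~ toZ S (Frob S).
Proof.
rewrite /Frob; case: xgetP => [z _ [] //|_].
by case.
Qed.

Lemma GCX_edges_sub (C : set int) (X : set nat) (e : set nat * set nat) :
  GCX_edges C X e -> [/\ NIX C X e.1, NIX C X e.2 & e.1 <> e.2].
Proof.
case=> e1 e2 e12; split=> // eq_e.
by apply: (@Frob_notin e.1); rewrite {1}eq_e e12; right.
Qed.

(* A graph has at least one vertex, so G(C,X) is defined for nonempty NI(C,X).
   Admissibility of X does not imply this: for C = {-4} and X = {2}, the only
   C-incentive containing X is the set of even numbers. *)
Definition GCX (C : set int) (X : set nat) (hne : NIX C X !=set0) :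
    graph (set nat) :=
  Graph hne (@GCX_edges_sub C X).

(* Main.v *)
(** Every S in NI(C,X) other than the maximum M becomes a larger element of
    NI(C,X) on adding F(S); as F(S) drops at each such step, iterating reaches
    M, and uniqueness of the path holds because each vertex has at most one
    outgoing edge and M has none.

    If m is the least positive integer lying in some S in NI(C,X), then
    M = {0} U [m, oo).  The key bound is that every c in C satisfies c >= -m,
    except that c = -2 is possible when m = 1.  Indeed, if d := -c - m > 0,
    then s - d = s + m + c lies in S for all nonzero s in S, so by descent d
    divides every element of S, and d = 1 since gcd(S) = 1; then S is closed
    under predecessors and 1 is in S. *)
Require Import Defs.
From mathcomp Require Import all_boot all_order all_algebra.
From mathcomp Require Import boolp classical_sets cardinality.
From mathcomp Require Import zify.

Set Implicit Arguments.
Unset Strict Implicit.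
Unset Printing Implicit Defensive.

Import Order.TTheory GRing.Theory Num.Theory.
Local Open Scope classical_set_scope.
Local Open Scope ring_scope.

(** * Subsets of N read in Z, and gcd 1 *)

Lemma least_nat (P : nat -> Prop) :
  (exists n, P n) -> exists2 n, P n & forall k, P k -> (n <= k)%N.
Proof.
case=> n Pn.
have exP : exists n, `[< P n >] by exists n; apply/asboolP.
case: (ex_minnP exP) => k /asboolP Pk kmin.
by exists k => // j Pj; apply: kmin; apply/asboolP.
Qed.

Lemma toZ_nat (M : set nat) (n : nat) : toZ M n%:Z <-> M n.
Proof.
split; last by exists n.
by case=> k Mk [<-].
Qed.

Lemma toZ_ge0 (M : set nat) (z : int) : toZ M z -> 0 <= z.
Proof. by case=> k _ <-. Qed.

Lemma toZ_inj : injective toZ.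
Proof.
move=> A B AB; apply/seteqP.
by split=> n /toZ_nat; [rewrite AB | rewrite -AB] => /toZ_nat.
Qed.

Lemma is_gcd1_dvd (S : set nat) (d : nat) :
  is_gcd S 1 -> (forall x, S x -> (d %| x)%N) -> d = 1%N.
Proof. by case=> _ S1 /S1; rewrite dvdn1 => /eqP. Qed.

Lemma is_gcd1_subset (A B : set nat) : A `<=` B -> is_gcd A 1 -> is_gcd B 1.
Proof.
move=> AB [_ A1]; split=> [x _|e eB]; first exact: dvd1n.
by apply: A1 => x /AB; apply: eB.
Qed.

Lemma is_gcd1_nonzero (S : set nat) : is_gcd S 1 -> exists s, nonzero S s.
Proof.
move=> S1; apply: contrapT => noS.
suff : 0%N = 1%N by [].
apply: (is_gcd1_dvd S1) => x Sx; rewrite dvd0n; apply/eqP.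
by apply: contrapT => x0; apply: noS; exists x.
Qed.

(** * Submonoids with gcd 1 are cofinite *)

Lemma submonoid_mul (S : set nat) (n x : nat) :
  submonoid S -> S x -> S (n * x)%N.
Proof.
move=> [S0 SD] Sx; elim: n => [|n IH]; first by rewrite mul0n.
by rewrite mulSn; apply: SD.
Qed.

(** Take the least positive difference [d] of two elements of [S]. For every [s] in [S], a nonzero
    remainder of [s] modulo [d] would be a smaller difference, so [d] divides all of [S]. *)
Lemma submonoid_succ (S : set nat) :
  submonoid S -> is_gcd S 1 -> exists x, S x /\ S x.+1.
Proof.
move=> mS S1; have [S0 SD] := mS.
pose P d := (0 < d)%N /\ exists x, S x /\ S (x + d)%N.
have [d [d_gt0 [x [Sx Sxd]]] dmin] :
    exists2 d, P d & forall k, P k -> (d <= k)%N.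
  apply: least_nat; have [s [Ss s0]] := is_gcd1_nonzero S1.
  by exists s; split; [rewrite lt0n; apply/eqP | exists 0%N].
suff d1 : d = 1%N by exists x; rewrite -addn1 -[in X in (_ + X)%N]d1.
apply: (is_gcd1_dvd S1) => s Ss; apply: contrapT => /negP ndvd.
have : (d <= s %% d)%N.
  apply: dmin; split; first by rewrite lt0n.
  (* With q = [s %/ d], the elements q(x + d) and qx + s of [S] differ by exactly [s %% d]. *)
  exists ((s %/ d) * (x + d))%N; split; first exact: submonoid_mul.
  have -> : ((s %/ d) * (x + d) + s %% d = (s %/ d) * x + s)%N.
    by rewrite mulnDr -addnA -divn_eq.
  by apply: SD => //; apply: submonoid_mul.
by rewrite leqNgt ltn_pmod.
Qed.

(** Write n = qx + r with r < x. Once n is at least x^2, q is at least r, and n = (q - r)x + r(x +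
    1) combines two consecutive elements of [S]. *)
Lemma submonoid_cofinite (S : set nat) :
  submonoid S -> is_gcd S 1 -> exists N, forall n, (N <= n)%N -> S n.
Proof.
move=> mS S1; have [x [Sx Sx1]] := submonoid_succ mS S1.
exists (x * x)%N => n n_ge.
have [x0|x_gt0] := posnP x.
  by rewrite -[n]muln1; apply: submonoid_mul => //; rewrite -x0.
have rq : (n %% x <= n %/ x)%N.
  by rewrite (leq_trans (ltnW (ltn_pmod _ x_gt0))) // leq_divRL.
have -> : (n = (n %/ x - n %% x) * x + (n %% x) * x.+1)%N.
  rewrite [LHS](divn_eq n x) mulnS mulnBl addnCA [RHS]addnC.
  by rewrite subnK ?leq_mul2r ?rq ?orbT.
by apply: mS.2; apply: submonoid_mul.
Qed.

(** * Existence and uniqueness of the Frobenius number *)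

Lemma is_frobenius_uniq (S : set nat) (y z : int) :
  is_frobenius S y -> is_frobenius S z -> y = z.
Proof.
move=> [yS ymax] [zS zmax]; apply/eqP.
by rewrite eq_le zmax // ymax.
Qed.

Lemma is_frobenius_Frob (S : set nat) (z : int) :
  is_frobenius S z -> Frob S = z.
Proof.
move=> zS; rewrite /Frob; case: xgetP => [y _ yS|/(_ z)//].
exact: is_frobenius_uniq yS zS.
Qed.

Lemma Frob_is_frobenius (S : set nat) :
  submonoid S -> is_gcd S 1 -> is_frobenius S (Frob S).
Proof.
move=> mS S1.
suff [z zS] : exists z, is_frobenius S z by rewrite (is_frobenius_Frob zS).
have [N SN Nmin] := least_nat (submonoid_cofinite mS S1).
(* [N] is the least start of a tail contained in [S]; for [N] = 0 this gives -1, which is outside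
   [S] by its sign. *)
exists (N%:Z - 1); split=> [SN1|w wS].
- have := toZ_ge0 SN1; case: N => [|N] in SN Nmin SN1 * => // _.
  suff : (N.+1 <= N)%N by rewrite ltnn.
  apply: Nmin => n; rewrite leq_eqVlt => /orP[/eqP<-|]; last exact: SN.
  by apply/toZ_nat; move: SN1; rewrite -natz -addn1 natrD addrK natz.
- rewrite leNgt; apply/negP => ltNw; apply: wS.
  have [n wn] : exists n : nat, w = n%:Z by exists `|w|%N; lia.
  by rewrite wn; apply/toZ_nat/SN; lia.
Qed.

(** * How negative the elements of C can be *)

Lemma incentive_lower_bound (C : set int) (S : set nat) (m : nat) (c : int) :
  NI C S -> nonzero S m -> C c ->
  - m%:Z <= c \/ S 1%N /\ c = - m%:Z - 1.
Proof.
move=> [[[S0 SD] SC] S1] Sm Cc.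
have [?|ltcm] := leP (- m%:Z) c; [by left | right].
pose d := `|- c - m%:Z|%N.
have d_gt0 : (0 < d)%N by rewrite /d; lia.
have step s : nonzero S s -> (d <= s)%N /\ S (s - d)%N.
  move=> Ss; have Ssd := SC _ _ _ Ss Sm Cc.
  have le_ds : (d <= s)%N by have := toZ_ge0 Ssd; rewrite /d; lia.
  split=> //; apply/toZ_nat.
  suff -> : (s - d)%N%:Z = s%:Z + m%:Z + c by [].
  by rewrite /d in le_ds *; lia.
have d1 : d = 1%N.
  apply: (is_gcd1_dvd S1); elim/ltn_ind => s IH Ss.
  have [->|s_gt0] := posnP s; first exact: dvdn0.
  have [le_ds Ssd] : (d <= s)%N /\ S (s - d)%N by apply: step; split=> //=; lia.
  by rewrite -(subnK le_ds) dvdn_addl // IH //; lia.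
split; last by rewrite /d in d1; lia.
(* Since [d] = 1, the predecessor of the least positive element [k] lies in [S], so it is 0 and [k]
   = 1. *)
have [k Sk kmin] := least_nat (is_gcd1_nonzero S1).
have [_ Sk1] := step k Sk; rewrite d1 in Sk1.
have [k1|k1] := eqVneq k 1%N; first by rewrite -k1; case: Sk.
have : (k <= k - 1)%N.
  by apply: kmin; split=> //= ?; move: k1; case: Sk => _ /=; lia.
by case: Sk => _ /=; lia.
Qed.

Lemma NI_setT (C : set int) (S : set nat) (n : nat) :
  NI C S -> S 1%N -> S n.
Proof.
by move=> [[mS _] _] S1; rewrite -[n]muln1; apply: submonoid_mul.
Qed.

(** * The maximum of NI(C,X), and adjoining F(S) *)

Section Tree.
Variables (C : set int) (X : set nat) (hne : NIX C X !=set0).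

Lemma NIX_Frob (S : set nat) : NIX C X S -> is_frobenius S (Frob S).
Proof. by move=> [[[mS _] S1] _]; apply: Frob_is_frobenius. Qed.

Lemma NIX_maximum : exists m : nat,
  [/\ (0 < m)%N,
      is_maximum (NIX C X) [set x | x = 0%N \/ (m <= x)%N] &
      forall c, C c -> - m%:Z <= c \/ m = 1%N /\ c = -2].
Proof.
pose P n := exists2 S, NIX C X S & nonzero S n.
have [m [S NS Sm] mmin] : exists2 m, P m & forall k, P k -> (m <= k)%N.
  apply: least_nat; have [S NS] := hne.
  by have [s Ss] := is_gcd1_nonzero NS.1.2; exists s, S.
have m_gt0 : (0 < m)%N by case: Sm => _ /=; lia.
have Cm c : C c -> - m%:Z <= c \/ m = 1%N /\ c = -2.
  move=> Cc; have [?|[S1 cE]] := incentive_lower_bound NS.1 Sm Cc; first by left.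
  by right; have : (m <= 1)%N by [apply: mmin; exists S]; lia.
have sub T : NIX C X T -> T `<=` [set x | x = 0%N \/ (m <= x)%N].
  move=> NT x Tx /=; have [->|x0] := eqVneq x 0%N; [by left | right].
  by apply: mmin; exists T => //; split=> //= /eqP; rewrite (negbTE x0).
exists m; split=> //; split=> //; split; last by move=> x /NS.2; apply: sub.
split; last exact: is_gcd1_subset (sub _ NS) NS.1.2.
split; first by split=> [|s t /= Hs Ht]; [left | lia].
move=> s t c [/= Hs s0] [/= Ht t0] Cc.
(* If [c] is at least -m, the sum is at least m. In the exceptional case m = 1 the set is all of N,
   and nonnegativity suffices. *)
have : 0 <= s%:Z + t%:Z + c by have := Cm _ Cc; lia.
case E : (s%:Z + t%:Z + c) => [n|//] _.
by apply/toZ_nat => /=; have := Cm _ Cc; lia.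
Qed.

Lemma NIX_Frob_edge (M S : set nat) :
  is_maximum (NIX C X) M -> NIX C X S -> S <> M ->
  exists S', edges (GCX hne) (S, S').
Proof.
move=> Mmax NS SM; have [m [m_gt0 Dmax Cm]] := NIX_maximum.
have MD : M = [set x | x = 0%N \/ (m <= x)%N].
  by apply/seteqP; split; [apply: Dmax.2 Mmax.1 | apply: Mmax.2 Dmax.1].
have [FS Fmax] := NIX_Frob NS.
have Fm : m%:Z <= Frob S.
  (* If F(S) were below [m], then [S] would contain all of [m, oo) and equal [M]. *)
  apply: contrapT => Fm; apply: SM; apply/seteqP; split; first exact: Mmax.2.
  rewrite MD => x [->|mx]; first exact: NS.1.1.1.1.
  by apply: contrapT => /toZ_nat/Fmax; lia.
have [f fE] : exists f : nat, Frob S = f%:Z by exists `|Frob S|%N; lia.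
rewrite fE in FS Fmax Fm.
have [[[mS SC] S1] XS] := NS.
have Sgt n : (f < n)%N -> S n.
  by move=> fn; apply: contrapT => /toZ_nat/Fmax; lia.
have Sm s : nonzero S s -> (m <= s)%N by case=> /(Dmax.2 _ NS) [] /=.
exists (S `|` [set f]); split=> //=; last first.
  rewrite fE /toZ image_setU; congr (_ `|` _).
  by apply/seteqP; split=> z /=; [case=> _ -> <- | move=> ->; exists f].
split; last by move=> x /XS; left.
split; last by apply: is_gcd1_subset S1 => x; left.
have Sge n : (f <= n)%N -> (S `|` [set f]) n.
  by rewrite leq_eqVlt => /orP[/eqP<-|/Sgt]; [right | left].
split.
  split; first by left; exact: mS.1.
  by move=> s t [Ss|->] [St|->]; [left; apply: mS.2 | apply: Sge; lia ..].
(* Only sums involving the new element [f] need care: as [t] is at least [m], they are at least [f]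
   unless [c] is below -m. *)
have key t c : nonzero (S `|` [set f]) t -> C c ->
    toZ (S `|` [set f]) (f%:Z + t%:Z + c).
  move=> [St t0] Cc /=.
  have mt : (m <= t)%N by case: St => [St|->]; [apply: Sm | lia].
  have [le_f|lt_f] := leP f%:Z (f%:Z + t%:Z + c).
    have [n nE] : exists n : nat, f%:Z + t%:Z + c = n%:Z.
      by exists (absz (f%:Z + t%:Z + c)); lia.
    by rewrite nE in le_f *; apply/toZ_nat/Sge; lia.
  have [t1 c2] : t = 1%N /\ c = -2 by have := Cm _ Cc; lia.
  (* If 1 lies in [S], then so does [f], which is absurd; otherwise [t] = [f] = 1 and the sum is
     0. *)
  case: St => [|tf]; first by rewrite t1 => /(NI_setT f NS.1) /toZ_nat.
  have -> : f%:Z + t%:Z + c = 0%N%:Z by rewrite /= in tf; lia.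
  by apply/toZ_nat; left; exact: mS.1.
move=> s t c Ss St Cc.
have [sf|sf] := eqVneq s f; first by rewrite sf; apply: key.
have [tf|tf] := eqVneq t f; first by rewrite tf (addrC s%:Z); apply: key.
have inS u : nonzero (S `|` [set f]) u -> u != f -> nonzero S u.
  by case=> [[Su|/= ->]] u0; rewrite ?eqxx.
have [n Sn nE] := SC s t c (inS s Ss sf) (inS t St tf) Cc.
by exists n => //; left.
Qed.

(** * Edges and walks of G(C,X) *)

Lemma edge_proper (S S' : set nat) : edges (GCX hne) (S, S') ->
  S `<=` S' /\ ~ S' `<=` S.
Proof.
case=> /= NS NS' SS'; split.
  by move=> x /toZ_nat Sx; apply/toZ_nat; rewrite SS'; left.
move=> S'S; apply: (@Frob_notin S).
have : toZ S' (Frob S) by rewrite SS'; right.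
by apply: image_subset.
Qed.

(** F(S') is also a gap of [S], and it differs from F(S), which belongs to [S']. *)
Lemma edge_Frob_lt (S S' : set nat) : edges (GCX hne) (S, S') ->
  Frob S' < Frob S.
Proof.
case=> /= NS NS' SS'.
have [FS Fmax] := NIX_Frob NS; have [FS' _] := NIX_Frob NS'.
rewrite lt_neqAle; apply/andP; split.
  by apply/eqP => E; apply: FS'; rewrite SS'; right.
by apply: Fmax => SF; apply: FS'; rewrite SS'; left.
Qed.

Lemma edge_functional (S S1 S2 : set nat) :
  edges (GCX hne) (S, S1) -> edges (GCX hne) (S, S2) -> S1 = S2.
Proof. by case=> /= _ _ E1 [/= _ _ E2]; apply: toZ_inj; rewrite E1 E2. Qed.

Lemma maximum_sink (M S : set nat) :
  is_maximum (NIX C X) M -> ~ edges (GCX hne) (M, S).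
Proof.
move=> [_ Mmax] MS; apply: (edge_proper MS).2.
by case: MS => _ NS _; apply: Mmax.
Qed.

Lemma walk_subset (S T : set nat) (p : seq (set nat * set nat)) e :
  walk (GCX hne) S T p -> e \in p -> S `<=` e.1.
Proof.
elim: p S => [//|[A B] p IH] S /= [AB <- w]; rewrite inE => /orP[/eqP->//|ep].
exact: subset_trans (edge_proper AB).1 (IH _ w ep).
Qed.

(** Vertices grow strictly along a walk; repeating an edge would put its target inside its
    source. *)
Lemma walk_uniq (S T : set nat) (p : seq (set nat * set nat)) :
  walk (GCX hne) S T p -> uniq p.
Proof.
elim: p S => [//|[A B] p IH] S /= [AB _ w]; rewrite (IH _ w) andbT.
by apply/negP => /(walk_subset w); apply: (edge_proper AB).2.
Qed.

Lemma walk_sink_unique (S M : set nat) (p q : seq (set nat * set nat)) :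
  is_maximum (NIX C X) M ->
  walk (GCX hne) S M p -> walk (GCX hne) S M q -> p = q.
Proof.
move=> Mmax; elim: p q S => [|[A B] p IH] [|[A' B'] q] S //=.
- by move=> -> [AB AM _]; rewrite AM in AB; case: (maximum_sink Mmax AB).
- by case=> AB AS _ SM; rewrite AS SM in AB; case: (maximum_sink Mmax AB).
move=> [AB <- wp] [AB' EA wq]; rewrite EA in AB' *.
by rewrite -(edge_functional AB AB') in wq *; rewrite (IH _ _ wp wq).
Qed.

Lemma walk_exists (S M : set nat) : is_maximum (NIX C X) M -> NIX C X S ->
  exists p, walk (GCX hne) S M p.
Proof.
move=> Mmax.
have [n] : exists n : nat, Frob S < n%:Z by exists `|Frob S|.+1; lia.
elim: n S => [|n IH] S ltFn NS;
  (have [->|SM] := pselect (S = M); first by exists [::]);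
  have [S' SS'] := NIX_Frob_edge Mmax NS SM.
(* Here F(S) < 0, so F(S) cannot lie in [S'] and no edge leaves [S]. *)
- have [/= _ _ SE] := SS'.
  have /toZ_ge0 : toZ S' (Frob S) by rewrite SE; right.
  by lia.
- have [||p wp] := IH S'; [by have := edge_Frob_lt SS'; lia | by case: SS' |].
  by exists ((S, S') :: p).
Qed.

Lemma GCX_tree (M : set nat) :
  is_maximum (NIX C X) M -> tree_with_root (GCX hne) M.
Proof.
move=> Mmax; split; first exact: Mmax.1.
move=> S NS _; have [p wp] := walk_exists Mmax NS.
exists p; split; first by split=> //; apply: walk_uniq wp.
by move=> q [wq _]; apply: walk_sink_unique Mmax wp wq.
Qed.

(** * Children of a vertex *)

Lemma children_GCX (S : set nat) : NIX C X S ->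
  children (GCX hne) S =
  [set S `\ a | a in [set a : nat |
     [/\ msg S a, Frob S < a%:Z, NI C (S `\ a) & ~ X a]]].
Proof.
move=> NS; have [FS Fmax] := NIX_Frob NS.
apply/seteqP; split=> [S' [/= NS' _ SS']|_ [a [[[Sa a0] _] ltFa NSa Xa] <-]].
- have [FS' Fmax'] := NIX_Frob NS'.
  (* The element removed from [S] is F(S'). *)
  have [a Sa aE] : toZ S (Frob S') by rewrite SS'; right.
  rewrite -aE in FS' Fmax' SS'.
  have S'a : ~ S' a by move/toZ_nat.
  have SE : S' = S `\ a.
    apply/seteqP; split=> x.
      move=> S'x; split; last by move=> xa; rewrite -xa in S'a.
      by apply/toZ_nat; rewrite SS'; left; apply/toZ_nat.
    move=> [/toZ_nat + xa]; rewrite SS' => -[/toZ_nat//|[xa']].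
    by case: xa.
  have [[[mS' _] _] XS'] := NS'.
  exists a; last by [].
  split; last 2 first; [by rewrite -SE; exact: NS'.1 | by move/XS' |..].
  + split; first by split=> //= a0; apply: S'a; rewrite a0; exact: mS'.1.
    (* Nonzero summands of [a] both differ from [a], hence lie in [S'], which would then contain
       [a]. *)
    case=> s [Ss s0] [t [St t0] sta]; apply: S'a.
    by rewrite -sta; apply: mS'.2; rewrite SE; split=> //= ?;
      move: s0 t0 => /=; lia.
  + rewrite lt_neqAle; apply/andP; split.
      by apply/eqP => E; apply: FS; rewrite E; apply/toZ_nat.
    by apply: Fmax' => S'F; apply: FS; rewrite SS'; left.
- have NSaX : NIX C X (S `\ a).
    by split=> // x Xx; split; [exact: NS.2 | move=> xa; rewrite -xa in Xa].
  split=> //=.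
  (* The integers outside the smaller set are [a] and those outside [S], which are all at most F(S)
     < [a]. *)
  have -> : Frob (S `\ a) = a%:Z.
    apply: is_frobenius_Frob; split; first by move/toZ_nat => [_]; apply.
    move=> w wS; have [Sw|Sw] := pselect (toZ S w); last first.
      by have := Fmax _ Sw; lia.
    case: Sw wS => n Sn <- wS; have [->//|na] := eqVneq n a.
    by case: wS; apply/toZ_nat; split=> //; apply/eqP.
  apply/seteqP; split=> [_ [n Sn <-]|z [[n [Sn _] <-]|->]].
  + have [->|na] := eqVneq n a; first by right.
    by left; apply/toZ_nat; split=> //; apply/eqP.
  + exact/toZ_nat.
  + exact/toZ_nat.
Qed.

End Tree.

Theorem theorem7p6 (C : set int) (X : set nat)
    (C_neq0 : C !=set0) (C_fin : finite_set C)
    (X_pos : X `<=` setT `\ 0%N) (X_adm : admissible C X)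
    (hne : NIX C X !=set0) :
  (exists M : set nat, is_maximum (NIX C X) M /\ tree_with_root (GCX hne) M)
  /\
  (forall S : set nat, NIX C X S ->
     children (GCX hne) S =
     [set S `\ a | a in [set a : nat |
       [/\ msg S a, Frob S < a%:Z, NI C (S `\ a) & ~ X a]]]).
Proof.
split; last exact: children_GCX.
have [m [_ Mmax _]] := NIX_maximum hne.
by exists [set x | x = 0%N \/ (m <= x)%N]; split=> //; apply: GCX_tree.
Qed.
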